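(* Let $E$ be an elliptic curve over $\mathbb{Q}$ of conductor $N_E$ which has a cyclic rational $4$-isogeny, and let $f_E$ be the weight $2$ cuspidal eigenform attached to $E$. Then $$ i_{f_E}(n) \ll n^{1/4} $$ for $n \gg 0$, where the implied constant depends only on $N_E$. That is, there is a constant $C>0$ depending only on $N_E$ such that $i_{f_E}(n)\le C n^{1/4}$ for all sufficiently large integers $n$.
   Context: For a cusp form $f(z)=\sum_{n\ge 1} a_f(n)q^n$ and $n\in\mathbb{N}$, define $i_f(n) := \max\{ i : a_f(n+j)=0 \text{ for all } 0\le j\le i\}$ (with $i_f(n)=0$ if $a_f(n)\neq 0$). An elliptic curve $E/\mathbb{Q}$ has a cyclic rational $4$-isogeny if there is an isogeny $\varphi:E\to E'$ of elliptic curves defined over $\mathbb{Q}$ with $\ker(\varphi)(\overline{\mathbb{Q}})\cong \mathbb{Z}/4\mathbb{Z}$. For an elliptic curve $E/\mathbb{Q}$ of conductor $N_E$, $f_E$ denotes the normalized cuspidal eigenform of weight $2$ and level $N_E$ with rational Fourier coefficients corresponding to $E$ by the modularity theorem. *)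

(* Defs.v *)
From HB Require Import structures.
From mathcomp Require Import all_boot all_order all_algebra all_field.
From mathcomp Require mpoly.

Set Implicit Arguments.
Unset Strict Implicit.
Unset Printing Implicit Defensive.

Import Order.TTheory GRing.Theory Num.Theory.
Local Open Scope ring_scope.

(* The notations of multinomials clash with those of MathComp-Analysis, so they
   are confined to this module. *)
Module Forms.
Import mpoly.

Definition homogeneous (d : nat) (F : {mpoly rat[3]}) : bool := F \is d.-homog.

Definition eval (F : {mpoly rat[3]}) (v : 'I_3 -> algC) : algC :=
  mmap (ratr : rat -> algC) v F.

End Forms.

From mathcomp Require Import all_classical all_reals all_analysis.
From mathcomp Require Import complex.
Import numFieldNormedType.Exports.
Local Open Scope ring_scope.

(* ** Weierstrass equations
   y^2 + a1 x y + a3 y = x^3 + a2 x^2 + a4 x + a6 *)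

Record weierstrass (A : Type) := Weierstrass { a1 : A; a2 : A; a3 : A; a4 : A; a6 : A }.

Definition map_weierstrass (A B : Type) (h : A -> B) (W : weierstrass A) :=
  Weierstrass (h (a1 W)) (h (a2 W)) (h (a3 W)) (h (a4 W)) (h (a6 W)).

Section Invariants.
Variables (A : comNzRingType) (W : weierstrass A).

Definition b2 : A := a1 W ^+ 2 + 4 * a2 W.
Definition b4 : A := 2 * a4 W + a1 W * a3 W.
Definition b6 : A := a3 W ^+ 2 + 4 * a6 W.
Definition b8 : A := a1 W ^+ 2 * a6 W + 4 * a2 W * a6 W - a1 W * a3 W * a4 W
  + a2 W * a3 W ^+ 2 - a4 W ^+ 2.
Definition c4 : A := b2 ^+ 2 - 24 * b4.
Definition disc : A :=
  - b2 ^+ 2 * b8 - 8 * b4 ^+ 3 - 27 * b6 ^+ 2 + 9 * b2 * b4 * b6.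

Definition affine_eq (x y : A) : bool :=
  y ^+ 2 + a1 W * x * y + a3 W * y ==
  x ^+ 3 + a2 W * x ^+ 2 + a4 W * x + a6 W.

End Invariants.

Record ellcurve (F : fieldType) := EllCurve {
  ell_weierstrass :> weierstrass F;
  ell_disc : disc ell_weierstrass != 0 }.

(* ** Points and the chord-tangent group law.
   [None] is the point at infinity O = [0 : 1 : 0]. *)

Definition point (F : Type) := option (F * F).

Definition map_point (F K : Type) (h : F -> K) (P : point F) : point K :=
  omap (fun xy => (h xy.1, h xy.2)) P.

Section Points.
Variables (F : fieldType) (W : weierstrass F).

Definition on_curve (P : point F) : bool :=
  if P is Some (x, y) then affine_eq W x y else true.

Definition add_point (P Q : point F) : point F :=
  match P, Q with
  | None, _ => Q
  | _, None => P
  | Some (x1, y1), Some (x2, y2) =>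
    if (x1 == x2) && (y1 + y2 + a1 W * x2 + a3 W == 0) then None else
    let l := if x1 == x2 then
               (3 * x1 ^+ 2 + 2 * a2 W * x1 + a4 W - a1 W * y1)
                 / (2 * y1 + a1 W * x1 + a3 W)
             else (y2 - y1) / (x2 - x1) in
    let x3 := l ^+ 2 + a1 W * l - a2 W - x1 - x2 in
    Some (x3, - (l + a1 W) * x3 - (y1 - l * x1) - a3 W)
  end.

Definition mul_point (n : nat) (P : point F) : point F :=
  iter n (add_point P) None.

Definition proj_coord (P : point F) (i : 'I_3) : F :=
  match P with
  | None => nth 0 [:: 0; 1; 0] i
  | Some (x, y) => nth 0 [:: x; y; 1] i
  end.

End Points.

(* ** Isogenies over Q, on points over the algebraic closure [algC] of Q. *)

Definition over_Qbar (E : ellcurve rat) : weierstrass algC :=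
  map_weierstrass (ratr : rat -> algC) E.

(* Value at P of the triple of forms F with rational coefficients. *)
Definition eval_forms (F : 'I_3 -> mpoly.mpoly 3 rat) (P : point algC)
    (i : 'I_3) : algC :=
  Forms.eval (F i) (proj_coord P).

(* phi is a morphism defined over Q: around every geometric point it is given,
   in projective coordinates, by forms of a common degree over Q. *)
Definition morphism_over_Q (E E' : ellcurve rat)
    (phi : point algC -> point algC) : Prop :=
  (forall P, on_curve (over_Qbar E) P -> on_curve (over_Qbar E') (phi P)) /\
  (forall P, on_curve (over_Qbar E) P ->
     exists (d : nat) (F : 'I_3 -> mpoly.mpoly 3 rat),
       [/\ forall i, Forms.homogeneous d (F i),
           exists i, eval_forms F P i != 0
         & forall Q, on_curve (over_Qbar E) Q ->
             (exists i, eval_forms F Q i != 0) ->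
             exists2 u : algC, u != 0 &
               forall i, eval_forms F Q i = u * proj_coord (phi Q) i]).

Definition isogeny_over_Q (E E' : ellcurve rat)
    (phi : point algC -> point algC) : Prop :=
  [/\ morphism_over_Q E E' phi,
      phi None = None
    & exists2 P, on_curve (over_Qbar E) P & phi P <> None].

Definition isog_ker (E : ellcurve rat) (phi : point algC -> point algC)
    (P : point algC) : Prop :=
  on_curve (over_Qbar E) P /\ phi P = None.

(* g is an isomorphism from Z/4Z onto ker(phi). *)
Definition has_cyclic_4_isogeny (E : ellcurve rat) : Prop :=
  exists (E' : ellcurve rat) (phi : point algC -> point algC),
    isogeny_over_Q E E' phi /\
    exists g : 'Z_4 -> point algC,
      [/\ injective g,
          forall i j, g (i + j) = add_point (over_Qbar E) (g i) (g j)
        & forall P, isog_ker E phi P <-> exists i, P = g i].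

(* ** Global minimal Weierstrass equations and reduction modulo p *)

(* W' is obtained from W by x = u^2 x' + r, y = u^3 y' + u^2 s x' + t. *)
Definition change_of_var (F : fieldType) (W W' : weierstrass F) (u r s t : F) :=
  [/\ u * a1 W' = a1 W + 2 * s,
      u ^+ 2 * a2 W' = a2 W - s * a1 W + 3 * r - s ^+ 2,
      u ^+ 3 * a3 W' = a3 W + r * a1 W + 2 * t,
      u ^+ 4 * a4 W' = a4 W - s * a3 W + 2 * r * a2 W - (t + r * s) * a1 W
                       + 3 * r ^+ 2 - 2 * s * t
    & u ^+ 6 * a6 W' = a6 W + r * a4 W + r ^+ 2 * a2 W + r ^+ 3 - t * a3 W
                       - t ^+ 2 - r * t * a1 W].

Definition integral_model (E : ellcurve rat) (W : weierstrass int) : Prop :=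
  exists u r s t : rat, u != 0 /\
    change_of_var E (map_weierstrass (intr : int -> rat) W) u r s t.

Definition minimal_model (E : ellcurve rat) (W : weierstrass int) : Prop :=
  integral_model E W /\
  forall W', integral_model E W' -> forall p : nat, prime p ->
    (logn p `|disc W|%N <= logn p `|disc W'|%N)%N.

Definition reduction (p : nat) (W : weierstrass int) : weierstrass 'F_p :=
  map_weierstrass (intr : int -> 'F_p) W.

(* p + 1 - #W(F_p), the projective points of the reduction being counted
   together with the singular point if there is one.  When W is minimal this is
   the coefficient a_p of the Euler factor of E at p also for bad p, where it
   equals 1, -1, 0 for split, nonsplit multiplicative, additive reduction. *)
Definition trace_frob (W : weierstrass int) (p : nat) : int :=
  p.+1%:Z - (#|[pred xy : 'F_p * 'F_p | affine_eq (reduction p W) xy.1 xy.2]|.+1)%:Z.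

(* ** The conductor: its exponent at p is the tame part
   (0, 1, 2 for good, multiplicative, additive reduction) plus the wild part
   \sum_(i >= 1) #|G_i| / #|G_0| * dim_{F_l} (E[l] / E[l]^{G_i}),
   for l <> p prime and G_i the ramification groups at p of Q(E[l]) / Q. *)

Definition tame_exponent (W : weierstrass int) (p : nat) : nat :=
  if disc (reduction p W) != 0 then 0
  else if c4 (reduction p W) != 0 then 1 else 2.

Section Ramification.
Variable L : splittingFieldType rat.

Definition integral_elt (x : L) : Prop := integralOver (intr : int -> L) x.

Definition prime_above (p : nat) (I : L -> Prop) : Prop :=
  [/\ forall x, I x -> integral_elt x,
      I (p%:R) /\ ~ I 1,
      forall x y, I x -> I y -> I (x + y),
      forall x y, integral_elt x -> I y -> I (x * y)
    & forall x y, integral_elt x -> integral_elt y -> I (x * y) -> I x \/ I y].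

Fixpoint ideal_pow (I : L -> Prop) (m : nat) (x : L) : Prop :=
  if m is m'.+1 then
    exists (k : nat) (u v : 'I_k -> L),
      [/\ forall j, I (u j), forall j, ideal_pow I m' (v j)
        & x = \sum_(j < k) u j * v j]
  else integral_elt x.

Definition ramification_group (I : L -> Prop) (i : nat) : {set gal_of {:L}} :=
  finset (fun g : gal_of {:L} => (g \in 'Gal({:L} / 1)%g) &&
    `[< forall x, integral_elt x -> ideal_pow I i.+1 (g x - x) >]).

(* s enumerates E[l], all of it is rational over L, and L = Q(E[l]). *)
Definition torsion_field (E : ellcurve rat) (l : nat) (s : seq (point L)) : Prop :=
  let EL := map_weierstrass (ratr : rat -> L) E in
  [/\ uniq s, size s = (l ^ 2)%N,
      forall P, (P \in s) = on_curve EL P && (mul_point EL l P == None)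
    & forall K : {subfield L},
        (forall x y, Some (x, y) \in s -> x \in K /\ y \in K) ->
        forall z : L, z \in K].

Definition fixed_dim (l : nat) (s : seq (point L)) (G : {set gal_of {:L}}) : nat :=
  logn l (count (fun P => [forall g in G, map_point (g : gal_of {:L}) P == P]) s).

End Ramification.

Definition wild_exponent (E : ellcurve rat) (p d : nat) : Prop :=
  exists (l : nat) (L : splittingFieldType rat) (s : seq (point L))
         (I : L -> Prop) (m : nat),
    [/\ prime l /\ l <> p, torsion_field E l s, prime_above p I,
        #|ramification_group I m| = 1%N
      & d%:R = \sum_(1 <= i < m)
          #|ramification_group I i|%:R / #|ramification_group I 0|%:R
          * (2 - fixed_dim l s (ramification_group I i))%N%:R :> rat].

Definition conductor (E : ellcurve rat) (N : nat) : Prop :=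
  (0 < N)%N /\
  exists2 W, minimal_model E W &
    forall p : nat, prime p ->
      exists2 d, wild_exponent E p d & logn p N = (tame_exponent W p + d)%N.

(* ** Cusp forms of weight 2 on Gamma_0(N) *)

Section CuspForms.
Variable R : realType.

(* The complex numbers as a normed module over themselves. *)
Local Notation C := ((R[i] : numFieldType)^o).

Definition upper_half (z : R[i]) : bool := 0 < complex.Im z.

Definition cexp (z : R[i]) : R[i] :=
  real_complex R (expR (complex.Re z)) *
  Complex (cos (complex.Im z)) (sin (complex.Im z)).

Definition nome (z : R[i]) : R[i] := cexp (Complex 0 (2 * pi) * z).

Definition moebius (a b c d : int) (z : R[i]) : R[i] :=
  (a%:~R * z + b%:~R) / (c%:~R * z + d%:~R).

Definition slash2 (f : R[i] -> R[i]) (a b c d : int) (z : R[i]) : R[i] :=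
  (c%:~R * z + d%:~R) ^- 2 * f (moebius a b c d z).

(* Only the values of f on the upper half-plane matter. *)
Definition cusp_form2 (N : nat) (f : R[i] -> R[i]) : Prop :=
  [/\ forall z, upper_half z -> derivable (f : C -> C) z 1,
      forall a b c d : int, a * d - b * c = 1 -> (N%:Z %| c)%Z ->
        forall z, upper_half z -> slash2 f a b c d z = f z
    & forall a b c d : int, a * d - b * c = 1 ->
        forall e : R, 0 < e -> exists Y : R, forall z, upper_half z ->
          Y < complex.Im z -> `|slash2 f a b c d z| < real_complex R e].

Definition q_expansion (f : R[i] -> R[i]) (a : nat -> R[i]) : Prop :=
  a 0 = 0 /\
  forall z, upper_half z ->
    (series (fun n => a n * nome z ^+ n : C) @ \oo --> (f z : C))%classic.

(* Coefficients of T_p f (of U_p f when p divides N), weight 2, level N. *)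
Definition hecke2 (N p : nat) (a : nat -> R[i]) (n : nat) : R[i] :=
  a (p * n)%N +
  (if ~~ (p %| N)%N && (p %| n)%N then p%:R * a (n %/ p)%N else 0).

Definition rational_eigenform2 (N : nat) (f : R[i] -> R[i]) (a : nat -> R[i]) : Prop :=
  [/\ cusp_form2 N f, q_expansion f a, a 1 = 1,
      forall n, exists r : rat, a n = ratr r
    & forall p : nat, prime p ->
        exists lam : R[i], forall n, hecke2 N p a n = lam * a n].

(* f = \sum a_n q^n is the eigenform f_E: its eigenvalues match the Euler
   factors of L(E, s), so that L(f, s) = L(E, s). *)
Definition attached_eigenform (E : ellcurve rat) (N : nat)
    (f : R[i] -> R[i]) (a : nat -> R[i]) : Prop :=
  rational_eigenform2 N f a /\
  exists2 W, minimal_model E W &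
    forall p : nat, prime p -> a p = (trace_frob W p)%:~R.

(* i = i_f(n): the largest i with a_n = ... = a_{n+i} = 0, and 0 if a_n != 0. *)
Definition is_gap (a : nat -> R[i]) (n i : nat) : Prop :=
  if a n == 0 then
    (forall j, (j <= i)%N -> a (n + j)%N = 0) /\
    (forall k, (forall j, (j <= k)%N -> a (n + j)%N = 0) -> (k <= i)%N)
  else i = 0%N.

End CuspForms.

(* Main.v *)
From HB Require Import structures.
Require Import Defs.
From mathcomp Require Import all_boot all_order all_algebra all_field.
From mathcomp Require Import all_fingroup all_solvable.
From mathcomp Require Import all_classical all_reals all_analysis.
From mathcomp Require Import complex.
From mathcomp Require Import ring lra zify.

(* The finite-set notions take precedence over the classical-set ones. *)
Import fintype mathcomp.boot.finset Order.TTheory GRing.Theory Num.Theory.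
Local Open Scope ring_scope.

Set Implicit Arguments.
Unset Strict Implicit.
Unset Printing Implicit Defensive.

(** A coefficient a_m is nonzero as soon as m is a sum of two squares congruent
to 1 modulo 6N, and such integers have gaps O(n^(1/4)).

Let P generate the kernel of the isogeny and T = 2P.  The kernel is stable under
automorphisms of the algebraic numbers ([isog_ker_map]); hence T is fixed, P is
fixed up to sign, and x(T), x(P) are rational ([cyclic4_halved_root]).  After
completing the square and moving x(T) to 0, the curve becomes
Y^2 = X (X^2 + A X + c^2), where c comes from x(P) - x(T).  This can be done with
integers A, c on any integral model ([halved_root_int]), so it survives reduction
modulo an odd prime p of good reduction.  Over a finite field of odd
characteristic such a curve, if nonsingular, has 3 modulo 4 affine points
([card_four_torsion_curve]): the maps (X, Y) -> (X, -Y) and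
(X, Y) -> (c^2/X, c^2 Y/X^2) act freely off the points with Y = 0 or X^2 = c^2,
which are counted separately.  So p = 1 mod 4 forces a_p <> 0 ([trace_frob_neq0]).

By the Hecke relations a is multiplicative, and for p not dividing N the a_(p^k)
form the Lucas sequence u_(k+2) = a_p u_(k+1) - p u_k.  For p > 3 it never vanishes
if a_p <> 0, and it is nonzero at even k if a_p = 0.  A prime
p = 3 mod 4 divides a sum of two squares to an even power, so every prime power
occurring in m contributes a nonzero factor ([sum2sqr_coef_neq0]).

Finally take a multiple x of 6N with n - x^2 = O(n^(1/2)), then y congruent to 1
modulo 6N with x^2 + y^2 just above n: the excess is O((n - x^2)^(1/2)), which is
O(n^(1/4)), with a constant that depends on N only ([sum2sqr_near]). *)

(** * Algebraic numbers fixed by all automorphisms *)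

(** In the splitting field of the minimal polynomial of x, which is Galois over Q,
every Galois automorphism extends to the algebraic numbers, so x lies in the fixed
field, namely Q. *)
Lemma aut_fixed_rat (x : algC) :
  (forall nu : {rmorphism algC -> algC}, nu x = x) -> exists q : rat, x = ratr q.
Proof.
move=> fix_x; have [p [Dp mon_p] minp] := minCpolyP x.
have [rs Drs] := closed_field_poly_normal (minCpoly x).
rewrite (monicP (minCpoly_monic x)) scale1r in Drs.
have [Qn [QnC [s Ds genQn]]] := num_field_exists rs.
pose pQ := map_poly (in_alg Qn) p.
have mapQ (q : {poly rat}) : map_poly QnC (map_poly (in_alg Qn) q) = map_poly ratr q.
  by rewrite -map_poly_comp; apply: eq_map_poly => a /=; rewrite alg_num_field fmorph_rat.
have DpQ : pQ = \prod_(y <- s) ('X - y%:P).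
  apply: (map_poly_inj QnC); rewrite mapQ -Dp Drs -Ds big_map rmorph_prod /=.
  by apply: eq_bigr => y _; rewrite map_polyXsubC.
have pQ1 : pQ \is a polyOver 1%AS.
  by apply/polyOverP => i; rewrite coef_map /= rpredZ ?rpred1.
have splitpQ : splittingFieldFor 1 pQ {:Qn}.
  by exists s; rewrite ?DpQ ?eqpxx.
have Qn_ax : FieldExt_isSplittingField _ Qn by constructor; exists pQ.
pose L := HB.pack_for (splittingFieldType rat) Qn Qn_ax.
have galL : galois 1 {:L}.
  rewrite /galois sub1v normalFieldf andbT /=.
  by apply/separableP => y _; apply: pcharf0_separable => c;
  rewrite pchar_lalg pchar_num.
have : x \in rs.
  by rewrite -root_prod_XsubC -Drs root_minCpoly.
rewrite -Ds => /mapP[z _ Dx].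
have : z \in fixedField 'Gal({:L} / 1)%g.
  apply/fixedFieldP; first exact: memvf.
  move=> g _; have [nu Dnu] := extend_algC_subfield_aut QnC (g : {rmorphism L -> L}).
  by apply: (fmorph_inj QnC); rewrite Dnu -Dx fix_x.
rewrite (galois_fixedField galL) => /vlineP[q Dz].
by exists q; rewrite Dx Dz alg_num_field fmorph_rat.
Qed.

(** * Duplication on a Weierstrass curve *)

(** The polynomial 4 x^3 + b2 x^2 + 2 b4 x + b6, equal to (2 y + a1 x + a3)^2
on the curve; its roots are the x-coordinates of the points of order 2. *)
Definition two_division (A : comNzRingType) (W : weierstrass A) (x : A) : A :=
  4 * x ^+ 3 + b2 W * x ^+ 2 + 2 * b4 W * x + b6 W.

(** For F the two-division polynomial, the second equation is F'(t) = 4 (x - t)^2.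
On an elliptic curve it says that the point of order 2 with x-coordinate t is the
double of the points with x-coordinate x. *)
Definition halved_root (A : comNzRingType) (W : weierstrass A) (t x : A) : Prop :=
  two_division W t = 0 /\ 6 * t ^+ 2 + b2 W * t + b4 W = 2 * (x - t) ^+ 2.

Section Morphism.
Variables (A B : comNzRingType) (h : {rmorphism A -> B}) (W : weierstrass A).

Lemma b2_map : b2 (map_weierstrass h W) = h (b2 W).
Proof. by rewrite /b2 /= !(rmorph_nat, rmorphXn, rmorphD, rmorphM). Qed.

Lemma b4_map : b4 (map_weierstrass h W) = h (b4 W).
Proof. by rewrite /b4 /= !(rmorph_nat, rmorphXn, rmorphD, rmorphM). Qed.

Lemma b6_map : b6 (map_weierstrass h W) = h (b6 W).
Proof. by rewrite /b6 /= !(rmorph_nat, rmorphXn, rmorphD, rmorphM). Qed.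

Lemma disc_map : disc (map_weierstrass h W) = h (disc W).
Proof.
by rewrite /disc /b8 b2_map b4_map b6_map /=
  !(rmorph_nat, rmorphXn, rmorphN, rmorphB, rmorphD, rmorphM).
Qed.

Lemma two_division_map x :
  two_division (map_weierstrass h W) (h x) = h (two_division W x).
Proof.
by rewrite /two_division b2_map b4_map b6_map
  !(rmorph_nat, rmorphXn, rmorphD, rmorphM).
Qed.

Lemma halved_root_map t x : injective h ->
  halved_root (map_weierstrass h W) (h t) (h x) -> halved_root W t x.
Proof.
move=> inj_h [Ht Hx]; split; apply: inj_h.
  by rewrite -two_division_map Ht rmorph0.
move: Hx; rewrite b2_map b4_map.
by rewrite !(rmorph_nat, rmorphXn, rmorphB, rmorphD, rmorphM).
Qed.

End Morphism.

Lemma double_two_torsion (F : fieldType) (W : weierstrass F) (x y : F) :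
  affine_eq W x y -> add_point W (Some (x, y)) (Some (x, y)) = None ->
  two_division W x = 0.
Proof.
rewrite /affine_eq /= eqxx /= => /eqP Exy; case: ifP => // /eqP Ey _.
have -> : two_division W x = (y + y + a1 W * x + a3 W) ^+ 2 - 4 *
   (y ^+ 2 + a1 W * x * y + a3 W * y
    - (x ^+ 3 + a2 W * x ^+ 2 + a4 W * x + a6 W)).
  by rewrite /two_division /b2 /b4 /b6; ring.
by rewrite Ey Exy; ring.
Qed.

(** With F the two-division polynomial and F(t) = 0, the duplication formula
gives 4 F(x) (x(2P) - t) = (2 (x - t)^2 - F'(t)/2)^2, and here x(2P) = t. *)
Lemma double_halved_root (F : fieldType) (W : weierstrass F) (x y t s : F) :
  affine_eq W x y -> add_point W (Some (x, y)) (Some (x, y)) = Some (t, s) ->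
  two_division W t = 0 -> halved_root W t x.
Proof.
rewrite /affine_eq /= eqxx /= => /eqP Exy; case: ifP => // /eqP Dn0 [Et _] Ht.
split=> //; apply: subr0_eq.
set D := 2 * y + a1 W * x + a3 W in Et.
have {}Dn0 : D != 0 by apply/eqP; move=> D0; apply: Dn0; rewrite -D0 /D; ring.
set n := 3 * x ^+ 2 + 2 * a2 W * x + a4 W - a1 W * y in Et.
have {}Et : D ^+ 2 * t = n ^+ 2 + a1 W * n * D - (a2 W + 2 * x) * D ^+ 2.
  by rewrite -Et; field.
(* It is enough that the square vanishes, by the duplication formula. *)
have sqr0 (z : F) : z ^+ 2 = 0 -> z = 0 by move/eqP; rewrite expf_eq0 => /eqP.
apply: sqr0.
set e := y ^+ 2 + a1 W * x * y + a3 W * y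
    - (x ^+ 3 + a2 W * x ^+ 2 + a4 W * x + a6 W).
have e0 : e = 0 by rewrite /e Exy subrr.
have -> : (6 * t ^+ 2 + b2 W * t + b4 W - 2 * (x - t) ^+ 2) ^+ 2 =
   4 * (n ^+ 2 + a1 W * n * D - (a2 W + 2 * x) * D ^+ 2 - D ^+ 2 * t)
   + 4 * (a1 W ^+ 2 + 4 * (a2 W + 2 * x) + 4 * t) * e
   + (4 * t + 8 * x + b2 W) * two_division W t.
  by rewrite /two_division /e /n /D /b2 /b4 /b6; ring.
by rewrite Ht -Et e0; ring.
Qed.

(** * Rationality of the cyclic kernel *)

Section KernelGalois.
Variable nu : {rmorphism algC -> algC}.

Lemma eval_forms_map (F : 'I_3 -> mpoly.mpoly 3 rat) (P : Defs.point algC) i :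
  eval_forms F (map_point nu P) i = nu (eval_forms F P i).
Proof.
rewrite /eval_forms /Forms.eval /mpoly.mmap rmorph_sum; apply: eq_bigr => m _.
rewrite rmorphM /= fmorph_rat /mpoly.mmap1 rmorph_prod; congr (_ * _).
apply: eq_bigr => j _; rewrite rmorphXn /=; congr (_ ^+ _).
case: P => [[x y]|] /=; case: j => [[|[|[|//]]] ?] //=; by rewrite ?rmorph0 ?rmorph1.
Qed.

Section RationalCoefficients.
Variable W : weierstrass algC.
Hypothesis fixW : map_weierstrass nu W = W.

Let coefs : [/\ nu (a1 W) = a1 W, nu (a2 W) = a2 W, nu (a3 W) = a3 W,
  nu (a4 W) = a4 W & nu (a6 W) = a6 W].
Proof. by split; rewrite -[in RHS]fixW. Qed.

Lemma on_curve_map P : on_curve W P -> on_curve W (map_point nu P).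
Proof.
case: P => [[x y]|] //=; rewrite /affine_eq => /eqP /(congr1 nu) e.
have [e1 e2 e3 e4 e6] := coefs; apply/eqP.
by move: e; rewrite !(rmorphXn, rmorphD, rmorphM) /= e1 e2 e3 e4 e6.
Qed.

Lemma add_point_map P Q :
  add_point W (map_point nu P) (map_point nu Q) = map_point nu (add_point W P Q).
Proof.
have [e1 e2 e3 e4 _] := coefs.
case: P => [[x1 y1]|] //; case: Q => [[x2 y2]|] //=.
rewrite (inj_eq (fmorph_inj nu)).
have -> : (nu y1 + nu y2 + a1 W * nu x2 + a3 W == 0) = (y1 + y2 + a1 W * x2 + a3 W == 0).
  by rewrite -[RHS](fmorph_eq0 nu) !(rmorphD, rmorphM) /= e1 e3.
case: ifP => //= _.
set l' := (if x1 == x2 then _ else (nu y2 - nu y1) / _).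
set l := (if x1 == x2 then _ else (y2 - y1) / _).
have <- : nu l = l'.
  rewrite /l /l'; case: ifP => _; rewrite fmorph_div.
    by rewrite !(rmorph_nat, rmorphXn, rmorphB, rmorphD, rmorphM) /= e1 ?e2 e3 ?e4.
  by rewrite !rmorphB.
by congr (Some (_, _)); rewrite !(rmorphXn, rmorphB, rmorphN, rmorphD, rmorphM) /= e1 e2 ?e3.
Qed.

End RationalCoefficients.

Variable E : ellcurve rat.

Lemma over_Qbar_fixed : map_weierstrass nu (over_Qbar E) = over_Qbar E.
Proof. by rewrite /over_Qbar /map_weierstrass /= !fmorph_rat. Qed.

(** Forms with rational coefficients commute with automorphisms.  Those that define
phi at P therefore define it at the conjugate of P, and give the same value
[0 : 1 : 0] there. *)
Lemma isog_ker_map (E' : ellcurve rat) (phi : Defs.point algC -> Defs.point algC) P :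
  morphism_over_Q E E' phi -> isog_ker E phi P -> isog_ker E phi (map_point nu P).
Proof.
move=> [_ Hphi] [onP kerP]; have onQ : on_curve (over_Qbar E) (map_point nu P).
  by apply: on_curve_map => //; exact: over_Qbar_fixed.
split=> //.
have [d [F [_ [i0 nz0] HF]]] := Hphi P onP.
have [|u _ evP] := HF P onP; first by exists i0.
have [|v nzv evQ] := HF (map_point nu P) onQ.
  by exists i0; rewrite eval_forms_map fmorph_eq0.
have := evQ (@Ordinal 3 2 isT); rewrite eval_forms_map evP kerP /= mulr0 rmorph0.
by case: (phi _) => // -[? ?] /= /esym/eqP; rewrite mulr1 (negPf nzv).
Qed.

End KernelGalois.

Lemma add_point_None_same_x (F : fieldType) (W : weierstrass F) P Q x y :
  P = Some (x, y) -> add_point W P Q = None -> exists y', Q = Some (x, y').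
Proof.
by move=> -> /=; case: Q => [[x' y']|] //; case: ifP => // /andP[/eqP -> _] _; exists y'.
Qed.

(** In Z/4 the element 2 is the only one of order 2, and the generators 1 and
3 = -1 give points with the same x-coordinate: conjugation fixes both
x-coordinates involved. *)
Lemma cyclic4_halved_root (E : ellcurve rat) :
  has_cyclic_4_isogeny E -> exists t x : rat, halved_root E t x.
Proof.
move=> [E' [phi [[morph_phi phiO _] [g [injg gD kerg]]]]].
have g0 : g 0 = None.
  have [i gi] : exists i, None = g i by apply/kerg; split.
  have : g (i + i) = g i by rewrite gD -gi.
  by move/injg/eqP; rewrite -subr_eq0 addrK => /eqP i0; rewrite gi i0.
have nu_g (nu : {rmorphism algC -> algC}) i : exists j, map_point nu (g i) = g j.
  apply/kerg/isog_ker_map; last by apply/kerg; exists i.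
  exact: morph_phi.
have dbl_g (nu : {rmorphism algC -> algC}) i j : map_point nu (g i) = g j ->
    map_point nu (g (i + i)) = g (j + j).
  by move=> eij; rewrite !gD -eij (add_point_map (over_Qbar_fixed nu E)).
(* [g] is injective, so only 0 goes to the point at infinity. *)
have gN0 i : i != 0 -> exists x y, g i = Some (x, y).
  case Egi: (g i) => [[x y]|]; first by exists x, y.
  by rewrite -g0 in Egi; rewrite (injg _ _ Egi) eqxx.
have [xP [yP gP]] := gN0 1 isT.
have [xT [yT gT]] := gN0 (1 + 1) isT.
have fixT (nu : {rmorphism algC -> algC}) : nu xT = xT.
  have [j gj] := nu_g nu (1 + 1).
  have : g (j + j) = None by rewrite -(dbl_g _ _ _ gj) (_ : _ + _ = 0) ?g0 //; apply: val_inj.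
  rewrite -g0 => /injg j2.
  have : j = 0 \/ j = 1 + 1 by move: j2; case: j {gj} => [[|[|[|[|//]]]] ?] // _;
     [left|right]; apply: val_inj.
  by case=> ej; move: gj; rewrite ej gT ?g0 //= => -[].
have fixP (nu : {rmorphism algC -> algC}) : nu xP = xP.
  have [j gj] := nu_g nu 1.
  have [yT' gT'] : exists y', g (j + j) = Some (xT, y').
    by rewrite -(dbl_g _ _ _ gj) gT /= fixT; exists (nu yT).
  have : j = 1 \/ 1 + j = 0.
    have [j0|j1|] : [\/ j + j = 0, j = 1 | 1 + j = 0].
      by case: j {gj gT'} => [[|[|[|[|//]]]] ?];
        [constructor 1|constructor 2|constructor 1|constructor 3]; apply: val_inj.
    - by rewrite j0 g0 in gT'.
    - by left.
    - by right.
  case=> ej; first by move: gj; rewrite ej gP => -[].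
  have := gD 1 j; rewrite ej g0 => /esym /(add_point_None_same_x gP)[y' gj'].
  by move: gj; rewrite gj' gP => -[].
have [t Et] := aut_fixed_rat fixT.
have [x Ex] := aut_fixed_rat fixP.
have onP i x' y' : g i = Some (x', y') -> affine_eq (over_Qbar E) x' y'.
  by move=> gi; have [_] := kerg (g i); case=> [|+ _]; [exists i | rewrite gi].
have Ht : two_division (over_Qbar E) xT = 0.
  by apply: (double_two_torsion (onP _ _ _ gT));
  rewrite -gT -gD (_ : _ + _ = 0) ?g0 //; apply: val_inj.
have dblP : add_point (over_Qbar E) (Some (xP, yP)) (Some (xP, yP)) = Some (xT, yT).
  by rewrite -gP -gT -gD.
exists t, x; apply: (halved_root_map (h := (ratr : {rmorphism rat -> algC}))).
  exact: fmorph_inj.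
by have := double_halved_root (onP _ _ _ gP) dblP Ht; rewrite Et Ex.
Qed.

(** * Passage to integral models *)

Section ChangeOfVariables.
Variables (F : fieldType) (W W' : weierstrass F) (u r s t : F).
Hypothesis chg : change_of_var W W' u r s t.

Lemma b2_change : u ^+ 2 * b2 W' = b2 W + 12 * r.
Proof.
have [e1 e2 _ _ _] := chg.
have -> : u ^+ 2 * b2 W' = (u * a1 W') ^+ 2 + 4 * (u ^+ 2 * a2 W') by rewrite /b2; ring.
by rewrite e1 e2 /b2; ring.
Qed.

Lemma b4_change : u ^+ 4 * b4 W' = b4 W + r * b2 W + 6 * r ^+ 2.
Proof.
have [e1 _ e3 e4 _] := chg.
have -> : u ^+ 4 * b4 W' = 2 * (u ^+ 4 * a4 W') + (u * a1 W') * (u ^+ 3 * a3 W').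
  by rewrite /b4; ring.
by rewrite e1 e3 e4 /b2 /b4; ring.
Qed.

Lemma b6_change : u ^+ 6 * b6 W' = b6 W + 2 * r * b4 W + r ^+ 2 * b2 W + 4 * r ^+ 3.
Proof.
have [_ _ e3 _ e6] := chg.
have -> : u ^+ 6 * b6 W' = (u ^+ 3 * a3 W') ^+ 2 + 4 * (u ^+ 6 * a6 W').
  by rewrite /b6; ring.
by rewrite e3 e6 /b2 /b4 /b6; ring.
Qed.

Lemma disc_change : u ^+ 12 * disc W' = disc W.
Proof.
have [e1 e2 e3 e4 e6] := chg.
have e8 : u ^+ 8 * b8 W' =
    b8 W + 3 * r * b6 W + 3 * r ^+ 2 * b4 W + r ^+ 3 * b2 W + 3 * r ^+ 4.
  have -> : u ^+ 8 * b8 W' = (u * a1 W') ^+ 2 * (u ^+ 6 * a6 W')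
      + 4 * (u ^+ 2 * a2 W') * (u ^+ 6 * a6 W')
      - (u * a1 W') * (u ^+ 3 * a3 W') * (u ^+ 4 * a4 W')
      + (u ^+ 2 * a2 W') * (u ^+ 3 * a3 W') ^+ 2 - (u ^+ 4 * a4 W') ^+ 2.
    by rewrite /b8; ring.
  by rewrite e1 e2 e3 e4 e6 /b2 /b4 /b6 /b8; ring.
have -> : u ^+ 12 * disc W' =
    - (u ^+ 2 * b2 W') ^+ 2 * (u ^+ 8 * b8 W') - 8 * (u ^+ 4 * b4 W') ^+ 3
    - 27 * (u ^+ 6 * b6 W') ^+ 2
    + 9 * (u ^+ 2 * b2 W') * (u ^+ 4 * b4 W') * (u ^+ 6 * b6 W').
  by rewrite /disc; ring.
by rewrite b2_change b4_change b6_change e8 /disc /b2 /b4 /b6 /b8; ring.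
Qed.

Lemma halved_root_change (a b : F) : u != 0 -> halved_root W a b ->
  halved_root W' ((a - r) / u ^+ 2) ((b - r) / u ^+ 2).
Proof.
move=> u0 [Ha Hb]; set a' := (a - r) / _; set b' := (b - r) / _.
have Ea : a = u ^+ 2 * a' + r by rewrite /a'; field.
have Eb : b = u ^+ 2 * b' + r by rewrite /b'; field.
have e2 := b2_change; have e4 := b4_change; have e6 := b6_change.
split.
  apply: (mulfI (expf_neq0 6 u0)); rewrite mulr0.
  have -> : u ^+ 6 * two_division W' a' = 4 * (u ^+ 2 * a') ^+ 3
     + (u ^+ 2 * b2 W') * (u ^+ 2 * a') ^+ 2 + 2 * (u ^+ 4 * b4 W') * (u ^+ 2 * a')
     + u ^+ 6 * b6 W' by rewrite /two_division; ring.
  rewrite e2 e4 e6 -Ha /two_division Ea; ring.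
apply: (mulfI (expf_neq0 4 u0)).
have -> : u ^+ 4 * (6 * a' ^+ 2 + b2 W' * a' + b4 W') = 6 * (u ^+ 2 * a') ^+ 2
   + (u ^+ 2 * b2 W') * (u ^+ 2 * a') + u ^+ 4 * b4 W' by ring.
have -> : u ^+ 4 * (2 * (b' - a') ^+ 2) = 2 * (b - a) ^+ 2 by rewrite Ea Eb; ring.
by rewrite e2 e4 -Hb Ea; ring.
Qed.

End ChangeOfVariables.

(** A rational algebraic integer is an integer. *)
Lemma rat_root_monic_int (p : {poly int}) (x : rat) :
  p \is monic -> root (map_poly intr p) x -> exists z : int, x = z%:~R.
Proof.
move=> mon_p px0.
have : (ratr x : algC) \in Num.int.
  apply: Cint_rat_Aint; first exact: Crat_rat.
  apply: (@root_monic_Aint (map_poly intr p)).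
  - suff -> : map_poly intr p = map_poly (ratr : rat -> algC) (map_poly intr p).
      by rewrite fmorph_root.
    by rewrite -map_poly_comp; apply: eq_map_poly => z /=; rewrite ratr_int.
  - exact: monic_map.
  - by apply/polyOverP => i; rewrite coef_map /= rpred_int.
by move/intrP=> [z Ez]; exists z; apply: (fmorph_inj (ratr : rat -> algC));
  rewrite /= [LHS]Ez ratr_int.
Qed.

(** The substitution X = 4 x - r, Y = 4 (2 y + a1 x + a3) turns the equation
into Y^2 = g(r + X) for the monic cubic g(u) = u^3 + b2 u^2 + 8 b4 u + 16 b6.
The two conditions are g(r) = 0 and g'(r) = c^2, so that
g(r + X) = X (X^2 + (b2 + 3 r) X + c^2). *)
Definition four_torsion_params (A : comNzRingType) (W : weierstrass A) (r c : A) : Prop :=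
  r ^+ 3 + b2 W * r ^+ 2 + 8 * b4 W * r + 16 * b6 W = 0 /\
  c ^+ 2 = 3 * r ^+ 2 + 2 * b2 W * r + 8 * b4 W.

(** Take r = 4 t and c = 4 (x - t): both are roots of monic integral polynomials. *)
Lemma halved_root_int (W : weierstrass int) (t x : rat) :
  halved_root (map_weierstrass intr W) t x ->
  exists r c : int, four_torsion_params W r c.
Proof.
set V := map_weierstrass _ W; move=> [Ht Hx].
have eb2 : b2 V = (b2 W)%:~R := b2_map intr W.
have eb4 : b4 V = (b4 W)%:~R := b4_map intr W.
have eb6 : b6 V = (b6 W)%:~R := b6_map intr W.
have Hr : (4 * t) ^+ 3 + (b2 W)%:~R * (4 * t) ^+ 2 + 8 * (b4 W)%:~R * (4 * t)
    + 16 * (b6 W)%:~R = 0.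
  by rewrite -eb2 -eb4 -eb6 -[RHS](mulr0 16) -Ht /two_division; ring.
have [r Er] : exists r : int, 4 * t = r%:~R.
  pose p : {poly int} := 'X^3 + (b2 W *: 'X^2 + (8 * b4 W) *: 'X + (16 * b6 W)%:P).
  have lt_p : (size (b2 W *: 'X^2 + (8 * b4 W) *: 'X + (16 * b6 W)%:P)%R
      < size ('X^3 : {poly int}))%N.
    rewrite size_polyXn ltnS; apply/leq_sizeP => -[|[|[|j]]] // _.
    by rewrite !coefD !coefZ coefXn coefX coefC /= !mulr0 !addr0.
  apply: (@rat_root_monic_int p).
    by rewrite monicE lead_coefDl // lead_coefXn.
  rewrite /root /p !rmorphD /= !map_polyZ map_polyC !map_polyXn map_polyX /= !hornerE.
  by rewrite -Hr; apply/eqP; rewrite !rmorphM /=; ring.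
have Hc : (4 * (x - t)) ^+ 2 = (3 * r ^+ 2 + 2 * b2 W * r + 8 * b4 W)%:~R.
  have -> : (4 * (x - t)) ^+ 2 = 8 * (2 * (x - t) ^+ 2) by ring.
  by rewrite -Hx eb2 eb4 !(rmorphD, rmorphM, rmorphXn) /= -Er; ring.
have [c Ec] : exists c : int, 4 * (x - t) = c%:~R.
  apply: (@rat_root_monic_int ('X^2 - (3 * r ^+ 2 + 2 * b2 W * r + 8 * b4 W)%:P)).
    exact: monicXnsubC.
  rewrite /root rmorphB /= map_polyC map_polyXn hornerD hornerN hornerC hornerXn.
  by rewrite Hc subrr.
exists r, c; split; apply: (intr_inj (R := rat)).
  by rewrite rmorph0 -Hr Er !(rmorphD, rmorphM, rmorphXn).
by rewrite rmorphXn /= -Ec Hc.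
Qed.

(** * Counting points over finite fields *)

(** The orbits of the group generated by f and g have size 4; they are removed one
at a time. *)
Lemma card_free_Klein (T : finType) (A : {set T}) (f g : T -> T) :
    {in A, forall x, f x \in A} -> {in A, forall x, g x \in A} ->
    {in A, involutive f} -> {in A, involutive g} -> {in A, forall x, f (g x) = g (f x)} ->
    {in A, forall x, [/\ f x != x, g x != x & f (g x) != x]} ->
  (4 %| #|A|)%N.
Proof.
move: {2}#|A| (leqnn #|A|) => n; elim: n A => [|n IHn] A leAn.
  by move: leAn; rewrite leqn0 => /eqP ->.
move=> fA gA fK gK fgC free.
have [->|/set0Pn[x Ax]] := eqVneq A set0; first by rewrite cards0.
have [fx gx fgx] := free x Ax.
have fxA := fA _ Ax; have gxA := gA _ Ax; have fgxA := fA _ gxA.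
pose O := [set x; f x; g x; f (g x)].
have inO y : (y \in O) = [|| y == x, y == f x, y == g x | y == f (g x)].
  by rewrite !inE -!orbA.
have fx_gx : f x != g x.
  by apply: contraNneq fgx => fxgx; rewrite -fxgx fK.
have fx_fgx : f x != f (g x).
  by apply: contraNneq gx => fxgx; rewrite -{2}(fK x Ax) fxgx fK.
have gx_fgx : g x != f (g x).
  by apply: contraNneq fx => e; rewrite -{2}(gK x Ax) e fgC // gK.
have cardO : #|O| = 4%N.
  have /card_uniqP : uniq [:: x; f x; g x; f (g x)].
    by rewrite /= !inE !negb_or fx_gx fx_fgx gx_fgx !(eq_sym x) fx gx fgx.
  by move=> /= <-; apply: eq_card => y; rewrite inO !inE.
have OA : O \subset A.
  by apply/subsetP => y; rewrite inO => /or4P[] /eqP ->.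
have fO y : y \in A -> (f y \in O) = (y \in O).
  move=> Ay; have ff z : z \in A -> (f y == z) = (y == f z).
    by move=> Az; apply/eqP/eqP => [<-|->]; rewrite fK.
  by rewrite !inO !ff // !fK //; do !case: (_ == _).
have gO y : y \in A -> (g y \in O) = (y \in O).
  move=> Ay; have gg z : z \in A -> (g y == z) = (y == g z).
    by move=> Az; apply/eqP/eqP => [<-|->]; rewrite gK.
  by rewrite !inO !gg // fgC // !gK // -fgC //; do !case: (_ == _).
have -> : #|A| = (4 + #|A :\: O|)%N.
  by rewrite -(cardsID O A) (setIidPr OA) cardO.
rewrite dvdn_addr //; apply: IHn.
- move: leAn; rewrite -(cardsID O A) (setIidPr OA) cardO; lia.
- by move=> y /setDP[Ay nOy]; rewrite inE fO // nOy fA.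
- by move=> y /setDP[Ay nOy]; rewrite inE gO // nOy gA.
- by move=> y /setDP[Ay _]; apply: fK.
- by move=> y /setDP[Ay _]; apply: gK.
- by move=> y /setDP[Ay _]; apply: fgC.
- by move=> y /setDP[Ay _]; apply: free.
Qed.

Section PointCount.
Variable F : finFieldType.
Hypothesis two_neq0 : (2 : F) != 0.

Definition num_sqrt (v : F) : nat := #|[set y : F | y ^+ 2 == v]|.

Lemma num_sqrtE (v : F) : v != 0 ->
  num_sqrt v = if [exists y, y ^+ 2 == v] then 2%N else 0%N.
Proof.
move=> v0; rewrite /num_sqrt; case: ifP => [/existsP[y /eqP yv]|/existsPn H].
  have -> : [set z | z ^+ 2 == v] = [set y; - y].
    by apply/setP => z; rewrite !inE -yv eqf_sqr.
  rewrite cards2; suff -> : y != - y by [].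
  rewrite -subr_eq0 opprK -mulr2n -mulr_natl mulf_neq0 //.
  by apply: contraNneq v0 => y0; rewrite -yv y0 expr0n.
apply/eqP; rewrite cards_eq0; apply/eqP/setP => y.
by rewrite !inE; apply/negbTE/H.
Qed.

(** The multiplicative group is cyclic and non-squares are the odd powers of a
generator. *)
Lemma nonsquareM (v w : F) :
  ~~ [exists y, y ^+ 2 == v] -> ~~ [exists y, y ^+ 2 == w] ->
  [exists y, y ^+ 2 == v * w].
Proof.
move=> nv nw.
have v0 : v != 0.
  by apply: contraNneq nv => ->; apply/existsP; exists 0; rewrite expr0n.
have w0 : w != 0.
  by apply: contraNneq nw => ->; apply/existsP; exists 0; rewrite expr0n.
have /cyclicP[z Ez] := field_unit_group_cyclic [set: {unit F}]%G.
have gen (x : F) : x != 0 -> exists k, x = val z ^+ k.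
  move=> x0; have Ux : x \is a GRing.unit by rewrite unitfE.
  have : FinRing.unit F Ux \in <[z]>%g by rewrite -Ez inE.
  by case/cycleP => k /(congr1 val) /= ->; exists k; rewrite FinRing.val_unitX.
have odd_gen (x : F) k : ~~ [exists y, y ^+ 2 == x] -> x = val z ^+ k -> odd k.
  move=> nx Ex; apply: contraR nx => ek; apply/existsP; exists (val z ^+ k./2).
  by rewrite -exprM Ex muln2 even_halfK.
have [k Ek] := gen v v0; have [l El] := gen w w0.
have ok := odd_gen _ _ nv Ek; have ol := odd_gen _ _ nw El.
apply/existsP; exists (val z ^+ (k + l)./2).
by rewrite -exprM muln2 even_halfK ?oddD ?ok ?ol // exprD -Ek -El.
Qed.

(** Either exactly one of v, w, v w is a square, or all three are: the sum is
2 or 6. *)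
Lemma num_sqrt_sum (v w : F) : v != 0 -> w != 0 ->
  (num_sqrt v + num_sqrt w + num_sqrt (v * w)%R = 2 %[mod 4])%N.
Proof.
move=> v0 w0; rewrite !num_sqrtE ?mulf_neq0 //.
have [/existsP[y /eqP yv]|nv] := boolP [exists y, y ^+ 2 == v].
  have y0 : y != 0 by apply: contraNneq v0 => y0; rewrite -yv y0 expr0n.
  have -> : [exists z, z ^+ 2 == v * w] = [exists z, z ^+ 2 == w].
    apply/existsP/existsP => -[z /eqP ez].
      exists (z / y); apply/eqP; rewrite expr_div_n ez -yv; field => //.
    by exists (y * z); rewrite exprMn ez yv.
  by case: ifP.
have [/existsP[y /eqP yw]|nw] := boolP [exists y, y ^+ 2 == w].
  have y0 : y != 0 by apply: contraNneq w0 => y0; rewrite -yw y0 expr0n.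
  case: ifP => // /existsP[z /eqP ez]; case/existsP: nv.
  by exists (z / y); apply/eqP; rewrite expr_div_n ez -yw; field.
by rewrite nonsquareM.
Qed.

(** Write al = A + 2 c and be = A - 2 c.  Off the points with Y = 0 or
X = c or X = - c, the maps (X, Y) -> (X, -Y) and
(X, Y) -> (c^2/X, c^2 Y/X^2) generate a free action of a group of order 4.  There
are 1 + n(al be) points with Y = 0, while X = c gives n(al) points and X = - c
gives n(be) points, where n counts square roots; [num_sqrt_sum] concludes. *)
Lemma card_four_torsion_curve (A c : F) : c != 0 -> A ^+ 2 - 4 * c ^+ 2 != 0 ->
  (#|[set v : F * F | v.2 ^+ 2 == v.1 * (v.1 ^+ 2 + A * v.1 + c ^+ 2)]%R|
     = 3 %[mod 4])%N.
Proof.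
move=> c0 d0; set S := [set v | _].
pose al := A + 2 * c; pose be := A - 2 * c.
have albe : al * be = A ^+ 2 - 4 * c ^+ 2 by rewrite /al /be; ring.
have al0 : al != 0 by apply: contraNneq d0 => h; rewrite -albe h mul0r.
have be0 : be != 0 by apply: contraNneq d0 => h; rewrite -albe h mulr0.
have inS x y : ((x, y) \in S) = (y ^+ 2 == x * (x ^+ 2 + A * x + c ^+ 2)).
  by rewrite inE.
pose Z := [set v : F * F | v.2 == 0].
pose P := [set v : F * F | v.1 == c].
pose Q := [set v : F * F | v.1 == - c].
(* The roots of X^2 + A X + c^2 are the (y - A) / 2 with y^2 = al be. *)
have cZ : #|S :&: Z| = (1 + num_sqrt (al * be)%R)%N.
  have -> : S :&: Z = (0, 0) |: [set ((y - A) / 2, 0) | y in [set y | y ^+ 2 == al * be]].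
    apply/setP => -[x y]; rewrite !inE /= xpair_eqE; apply/andP/orP.
      move=> [/eqP e /eqP y0]; rewrite y0 eqxx andbT; move: e.
      rewrite y0 expr0n /= => /esym/eqP; rewrite mulf_eq0 => /orP[->|/eqP e]; [by left | right].
      apply/imsetP; exists (2 * x + A); last by congr (_, _); field.
      rewrite inE albe -subr_eq0; apply/eqP; rewrite -[RHS](mulr0 4) -e; ring.
    case=> [/andP[/eqP -> /eqP ->]|/imsetP[z]].
      by rewrite expr0n mul0r.
    rewrite inE albe => /eqP ez [-> ->]; rewrite expr0n /=; split=> //.
    apply/eqP/esym; apply: (mulIf (expf_neq0 2 two_neq0)); rewrite mul0r.
    transitivity ((z - A) / 2 * (z ^+ 2 - (A ^+ 2 - 4 * c ^+ 2))); first by field.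
    by rewrite ez subrr mulr0.
  have z1_notin : (0, 0) \notin [set ((y - A) / 2, 0 : F) | y in [set y | y ^+ 2 == al * be]].
    apply/imsetP => -[z]; rewrite inE albe => /eqP ez [].
    move/esym/eqP; rewrite mulf_eq0 invr_eq0 (negPf two_neq0) orbF subr_eq0 => /eqP zA.
    have /eqP : 2 * 2 * c ^+ 2 = 0 :> F.
      by rewrite -[RHS](subrr (z ^+ 2)) {2}ez zA; ring.
    by rewrite !mulf_eq0 (negPf two_neq0) (negPf c0).
  rewrite cardsU1 z1_notin card_imset //.
  by move=> z1 z2 [] /(mulIf (invr_neq0 two_neq0)) /addIr.
(* At X = c the right-hand side is c^2 al. *)
have cP : #|(S :\: Z) :&: P| = num_sqrt al.
  have -> : (S :\: Z) :&: P = [set (c, c * y) | y in [set y | y ^+ 2 == al]].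
    apply/setP => -[x y]; rewrite !inE /=; apply/andP/imsetP.
      move=> [/andP[_ /eqP e] /eqP xc]; exists (y / c); last first.
        by rewrite xc; congr (_, _); field.
      by rewrite inE expr_div_n e xc /al; apply/eqP; field.
    move=> [z]; rewrite inE => /eqP ez [-> ->]; rewrite eqxx mulf_eq0 (negPf c0) /=.
    have z0 : z != 0 by apply: contraNneq al0 => z0; rewrite -ez z0 expr0n.
    by rewrite z0 exprMn ez /al; split=> //; apply/eqP; ring.
  by rewrite card_imset // => z1 z2 [] /(mulfI c0).
have cN0 : c != - c.
  by rewrite -subr_eq0 opprK -mulr2n -mulr_natl mulf_neq0.
(* At X = - c the right-hand side is c^2 be. *)
have cQ : #|((S :\: Z) :\: P) :&: Q| = num_sqrt be.
  have -> : ((S :\: Z) :\: P) :&: Q = [set (- c, c * y) | y in [set y | y ^+ 2 == be]].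
    apply/setP => -[x y]; rewrite !inE /=; apply/andP/imsetP.
      move=> [/and3P[_ _ /eqP e] /eqP xc]; exists (y / c); last first.
        by rewrite xc; congr (_, _); field.
      by rewrite inE expr_div_n e xc /be; apply/eqP; field.
    move=> [z]; rewrite inE => /eqP ez [-> ->]; rewrite eqxx mulf_eq0 (negPf c0) /=.
    have z0 : z != 0 by apply: contraNneq be0 => z0; rewrite -ez z0 expr0n.
    by rewrite z0 eq_sym cN0 exprMn ez /be; split=> //; apply/eqP; ring.
  by rewrite card_imset // => z1 z2 [] /(mulfI c0).
have cR : (4 %| #|((S :\: Z) :\: P) :\: Q|)%N.
  set R := _ :\: Q.
  have inR x y : ((x, y) \in R) =
      [&& x != - c, x != c, y != 0 & y ^+ 2 == x * (x ^+ 2 + A * x + c ^+ 2)].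
    by rewrite !inE.
  have x0R x y : (x, y) \in R -> x != 0.
    rewrite inR => /and4P[_ _ y0]; apply: contraTneq => ->.
    by rewrite mul0r expf_eq0.
  pose f (v : F * F) := (v.1, - v.2).
  pose g (v : F * F) := (c ^+ 2 / v.1, c ^+ 2 * v.2 / v.1 ^+ 2).
  have c2x x e : x != 0 -> (c ^+ 2 / x == e * c) = (c == e * x).
    move=> x0; rewrite -(inj_eq (mulIf x0)) divfK // expr2 mulrAC.
    by rewrite (inj_eq (mulIf c0)).
  apply: (@card_free_Klein _ R f g).
  - by move=> [x y]; rewrite !inR /= oppr_eq0 sqrrN.
  - move=> [x y] xyR; have x0 := x0R _ _ xyR; move: xyR; rewrite !inR /=.
    move=> /and4P[xNc xc y0 /eqP e]; apply/and4P; split.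
    + by rewrite -mulN1r c2x // mulN1r eq_sym eqr_oppLR.
    + by rewrite -[X in _ != X]mul1r c2x // mul1r eq_sym.
    + by rewrite !mulf_neq0 ?expf_neq0 // invr_neq0 ?expf_neq0.
    + by rewrite expr_div_n exprMn e; apply/eqP; field.
  - by move=> [x y] _; rewrite /f /= opprK.
  - by move=> [x y] /x0R x0; rewrite /g /=; congr (_, _); field; apply/andP.
  - by move=> [x y] /x0R x0; rewrite /f /g /= mulrN mulNr.
  - move=> [x y] xyR; have x0 := x0R _ _ xyR; move: xyR; rewrite inR /f /g /=.
    move=> /and4P[xNc xc y0 _]; rewrite !xpair_eqE /=.
    have x2 : c ^+ 2 / x == x = false.
      apply/eqP => e; have : c ^+ 2 = x ^+ 2 by rewrite [RHS]expr2 -{1}e divfK.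
      move/eqP; rewrite eqf_sqr => /orP[] /eqP e'; first by rewrite e' eqxx in xc.
      by rewrite e' opprK eqxx in xNc.
    rewrite !x2 /= eqxx; split=> //.
    by rewrite eq_sym -subr_eq0 opprK -mulr2n -mulr_natl mulf_neq0.
rewrite -(cardsID Z S) cZ -(cardsID P (S :\: Z)) cP -(cardsID Q (S :\: Z :\: P)) cQ.
have := num_sqrt_sum al0 be0; case/dvdnP: cR => k ->.
set x := num_sqrt _; set y := num_sqrt _; set z := num_sqrt _.
lia.
Qed.

End PointCount.

(** * Traces of Frobenius at good primes *)

Lemma four_torsion_params_map (A B : comNzRingType) (h : {rmorphism A -> B})
    (W : weierstrass A) r c :
  four_torsion_params W r c -> four_torsion_params (map_weierstrass h W) (h r) (h c).
Proof.
move=> [/(congr1 h) Hr /(congr1 h) Hc]; move: Hr Hc.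
rewrite /four_torsion_params b2_map b4_map b6_map.
by rewrite !(rmorph0, rmorph_nat, rmorphXn, rmorphD, rmorphM).
Qed.

(** The cubic X (X^2 + A X + c^2) has discriminant c^4 (A^2 - 4 c^2), and passing
from the Weierstrass equation to this cubic multiplies the discriminant by 2^8. *)
Lemma disc_four_torsion (A : comNzRingType) (W : weierstrass A) r c :
  four_torsion_params W r c ->
  256 * disc W = c ^+ 4 * ((b2 W + 3 * r) ^+ 2 - 4 * c ^+ 2).
Proof.
move=> [Hr Hc].
have -> : c ^+ 4 = (c ^+ 2) ^+ 2 by ring.
have -> : 256 * disc W = - 4 * b2 W ^+ 3 * (16 * b6 W) + 64 * b2 W ^+ 2 * b4 W ^+ 2
    - 2048 * b4 W ^+ 3 - 27 * (16 * b6 W) ^+ 2 + 144 * b2 W * b4 W * (16 * b6 W).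
  by rewrite /disc /b8 /b2 /b4 /b6; ring.
have -> : 16 * b6 W = - (r ^+ 3 + b2 W * r ^+ 2 + 8 * b4 W * r).
  by apply/eqP; rewrite -addr_eq0 addrC Hr.
by rewrite Hc; ring.
Qed.

Lemma card_affine_four_torsion (F : finFieldType) (W : weierstrass F) r c :
  (2 : F) != 0 -> disc W != 0 -> four_torsion_params W r c ->
  (#|[pred xy : F * F | affine_eq W xy.1 xy.2]| = 3 %[mod 4])%N.
Proof.
move=> two0 disc0 params; have Edisc := disc_four_torsion params.
have [Hr Hc] := params.
have four0 : (4 : F) != 0.
  by have -> : (4 : F) = 2 * 2 by [ring]; rewrite mulf_neq0.
have [c0 d0] : c != 0 /\ (b2 W + 3 * r) ^+ 2 - 4 * c ^+ 2 != 0.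
  have : 256 * disc W != 0.
    have -> : (256 : F) = 2 ^+ 8 by ring.
    by rewrite mulf_neq0 ?expf_neq0.
  by rewrite Edisc mulf_eq0 expf_eq0 /= negb_or => /andP[].
rewrite -(card_four_torsion_curve two0 c0 d0).
pose h (v : F * F) := (4 * v.1 - r, 4 * (2 * v.2 + a1 W * v.1 + a3 W)).
have inj_h : injective h.
  move=> [x y] [x' y'] [/addIr /(mulfI four0) ->].
  by move=> /(mulfI four0) /addIr /addIr /(mulfI two0) ->.
congr (_ %% 4)%N; rewrite -(card_image inj_h [pred xy | affine_eq W xy.1 xy.2]).
apply: eq_card => -[X Y].
rewrite [RHS]inE /=.
(* The change of variables multiplies the equation of the curve by 64. *)
have key x y : (4 * (2 * y + a1 W * x + a3 W)) ^+ 2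
    - (4 * x - r) * ((4 * x - r) ^+ 2 + (b2 W + 3 * r) * (4 * x - r) + c ^+ 2)
  = 2 ^+ 6 * (y ^+ 2 + a1 W * x * y + a3 W * y
    - (x ^+ 3 + a2 W * x ^+ 2 + a4 W * x + a6 W)).
  apply: subr0_eq; rewrite Hc -[RHS]Hr /b2 /b4 /b6; ring.
apply/imageP/eqP => [[[x y] + [-> ->]]|e].
  rewrite inE /affine_eq /= => /eqP e.
  by apply: subr0_eq; rewrite key e subrr mulr0.
pose x := (X + r) / 4; pose y := (Y / 4 - a1 W * x - a3 W) / 2.
have EX : X = 4 * x - r by rewrite /x; field.
have EY : Y = 4 * (2 * y + a1 W * x + a3 W).
  by rewrite /y; field; apply/andP.
exists (x, y); last by rewrite /h /= -EX -EY.
rewrite inE /affine_eq /= -subr_eq0 -(mulrI_eq0 _ (mulfI (expf_neq0 6 two0))).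
by rewrite -key -EX -EY e subrr.
Qed.

(** If the trace vanished there would be exactly p affine points, and p is not
3 modulo 4. *)
Lemma trace_frob_neq0 (W : weierstrass int) (r c : int) (p : nat) :
  four_torsion_params W r c -> prime p -> (p %% 4 = 1)%N ->
  disc (reduction p W) != 0 -> trace_frob W p != 0.
Proof.
move=> params pr_p p1 disc0; rewrite /trace_frob subr_eq0 eqz_nat eqSS.
have two0 : (2 : 'F_p) != 0.
  rewrite -(dvdn_pcharf (pchar_Fp pr_p)) gtnNdvd //.
  by have := prime_gt1 pr_p; case: (p) p1 => [|[|[|]]].
have := card_affine_four_torsion two0 disc0 (four_torsion_params_map intr params).
by move=> e; apply/eqP => ep; move: e; rewrite -ep p1.
Qed.

Lemma disc_reduction (p : nat) (W : weierstrass int) : prime p ->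
  (disc (reduction p W) == 0) = (p %| `|disc W|)%N.
Proof.
move=> pr_p; rewrite /reduction (disc_map intr).
by rewrite -(dvdz_pcharf (pchar_Fp pr_p)) dvdzE.
Qed.

(** The minimal model that computes the conductor may differ from W, but minimality
gives both discriminants the same valuation at p. *)
Lemma conductor_good_reduction (E : ellcurve rat) (N : nat) (W : weierstrass int) (p : nat) :
  conductor E N -> minimal_model E W -> prime p -> ~~ (p %| N)%N ->
  disc (reduction p W) != 0.
Proof.
move=> [N0 [W0 [mod0 min0] condN]] [modW minW] pr_p pN.
have disc_neq0 V : integral_model E V -> disc V != 0.
  move=> [u [r [s [t [u0 /disc_change e]]]]].
  rewrite -(intr_eq0 rat) -disc_map; apply: contraNneq (ell_disc E) => d0.
  by rewrite -e d0 mulr0.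
have [d _ Nd] := condN p pr_p.
have tame0 : tame_exponent W0 p = 0%N.
  by move: Nd; rewrite lognE (negPf pN) !andbF; lia.
have nd0 : ~~ (p %| `|disc W0|)%N.
  rewrite -disc_reduction //; move: tame0.
  by rewrite /tame_exponent; case: ifP => // _; case: ifP.
rewrite disc_reduction //.
have := minW W0 mod0 p pr_p; rewrite [logn p `|disc W0|%N]lognE (negPf nd0) !andbF.
by rewrite leqn0 lognE pr_p absz_gt0 disc_neq0 //=; case: ifP.
Qed.

(** * Coefficients of an eigenform *)

(** Here a and b are the sum and the product of two numbers, and [lucas a b k] is
the complete symmetric polynomial of degree k in them; for b = p and a = a_p this
is the coefficient of index p^k. *)
Fixpoint lucas (a b : int) (k : nat) : int :=
  match k with
  | 0 => 1
  | k'.+1 => match k' with 0 => a | k''.+1 => a * lucas a b k' - b * lucas a b k'' end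
  end.

Lemma lucasSS a b k : lucas a b k.+2 = a * lucas a b k.+1 - b * lucas a b k.
Proof. by []. Qed.

Lemma lucas0_double b k : lucas 0 b k.*2 = (- b) ^+ k.
Proof.
by elim: k => [|k IHk] //; rewrite doubleS lucasSS mul0r sub0r IHk exprS mulNr.
Qed.

(** If p does not divide a, the k-th term is a^k modulo p.  Otherwise
|a| >= p >= 4 and the absolute values at least double at each step. *)
Lemma lucas_neq0 (a : int) (p k : nat) :
  prime p -> (3 < p)%N -> a != 0 -> lucas a p k != 0.
Proof.
move=> pr_p p_gt3 a0; have [pa|npa] := boolP (p %| `|a|)%N; last first.
  have coprime_pow j : ~~ (p%:Z %| a ^+ j)%Z.
    rewrite dvdzE abszX /= Euclid_dvdX // negb_and npa //.
  suff dvd_sub j : (p%:Z %| lucas a p j - a ^+ j)%Z /\ (p%:Z %| lucas a p j.+1 - a ^+ j.+1)%Z.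
    apply: contra (coprime_pow k) => /eqP uk; have [+ _] := dvd_sub k.
    by rewrite uk sub0r rpredN.
  elim: j => [|j [_ IH]]; first by rewrite /= expr0 expr1 !subrr.
  split=> //; rewrite lucasSS exprS.
  have -> : a * lucas a p j.+1 - p%:Z * lucas a p j - a * a ^+ j.+1 =
    a * (lucas a p j.+1 - a ^+ j.+1) - p%:Z * lucas a p j by ring.
  by apply: rpredB; [apply: dvdz_mull | apply: dvdz_mulr].
have le_pa : p%:Z <= `|a|.
  by rewrite -[`|a|]abszE lez_nat dvdn_leq // absz_gt0.
suff : 0 < `|lucas a p k| /\ 2 * `|lucas a p k| <= `|lucas a p k.+1|.
  by rewrite normr_gt0 => -[].
elim: k => [|k [IH0 IH]].
  by rewrite /= normr1; split=> //; lia.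
split; first by apply: lt_le_trans IH; rewrite mulr_gt0.
rewrite lucasSS.
have : `|a * lucas a p k.+1| - `|p%:Z * lucas a p k| <=
   `|a * lucas a p k.+1 - p%:Z * lucas a p k| by exact: lerB_dist.
apply: le_trans; rewrite !normrM.
have : p%:Z * `|lucas a p k.+1| <= `|a| * `|lucas a p k.+1| by apply: ler_wpM2r.
have -> : `|p%:Z| = p%:Z by [].
move: IH; set U1 := `|lucas a p k.+1|; set U0 := `|lucas a p k| => IH le_A.
have h1 : p%:Z * (2 * U0) <= p%:Z * U1 by rewrite ler_wpM2l.
have h2 : 4 * U1 <= p%:Z * U1 by rewrite ler_wpM2r ?normr_ge0 // lez_nat.
lia.
Qed.

Section Hecke.
Variables (K : numFieldType) (N : nat) (a : nat -> K) (ap : nat -> int).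
Hypothesis a1E : a 1 = 1.
Hypothesis apE : forall p, prime p -> a p = (ap p)%:~R.
Hypothesis heckeE : forall p, prime p -> exists lam : K, forall n,
  a (p * n)%N + (if ~~ (p %| N)%N && (p %| n)%N then p%:R * a (n %/ p)%N else 0)
    = lam * a n.

Lemma hecke_coprime p n : prime p -> ~~ (p %| n)%N -> a (p * n)%N = a p * a n.
Proof.
move=> pr_p pn; have [lam H] := heckeE pr_p.
have := H n; rewrite (negPf pn) andbF addr0 => ->.
by have := H 1%N; rewrite muln1 dvdn1 (gtn_eqF (prime_gt1 pr_p)) andbF addr0 a1E mulr1 => ->.
Qed.

Lemma hecke_prime p n : prime p -> ~~ (p %| N)%N ->
  a (p * (p * n))%N = a p * a (p * n)%N - p%:R * a n.
Proof.
move=> pr_p pN; have [lam H] := heckeE pr_p.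
have := H 1%N; rewrite muln1 dvdn1 (gtn_eqF (prime_gt1 pr_p)) andbF addr0 a1E mulr1 => ->.
by rewrite -H pN dvdn_mulr // mulKn ?prime_gt0 // addrK.
Qed.

Lemma hecke_prime_pow p k m : prime p -> ~~ (p %| N)%N -> ~~ (p %| m)%N ->
  a (p ^ k * m)%N = (lucas (ap p) p k)%:~R * a m.
Proof.
move=> pr_p pN pm.
suff [] : a (p ^ k * m)%N = (lucas (ap p) p k)%:~R * a m /\
    a (p ^ k.+1 * m)%N = (lucas (ap p) p k.+1)%:~R * a m by [].
elim: k => [|k [IH0 IH1]].
  by split; rewrite ?expn0 ?mul1n ?mul1r // expn1 hecke_coprime // apE.
split=> //; rewrite lucasSS !expnS -!mulnA hecke_prime // mulnA -expnS IH1 IH0 apE //.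
by rewrite rmorphB !rmorphM /= mulrBl !mulrA.
Qed.

(** Split off the power of one prime at a time. *)
Lemma hecke_neq0 m : (0 < m)%N ->
  (forall p, prime p -> (p %| m)%N ->
     ~~ (p %| N)%N /\ lucas (ap p) p (logn p m) != 0) ->
  a m != 0.
Proof.
elim/ltn_ind: m => m IHm m0 Hm.
have [m1|m1] := leqP m 1.
  have -> : m = 1%N by lia.
  by rewrite a1E oner_eq0.
have pr_p := pdiv_prime m1; set p := pdiv m in pr_p.
have pm : (p %| m)%N := pdiv_dvd m.
have [m' pm' Em] := pfactor_coprime pr_p m0.
rewrite prime_coprime // in pm'.
have [pN up] := Hm p pr_p pm.
have m'0 : (0 < m')%N by case: m' pm' {Em} => //; rewrite dvdn0.
have k0 : (0 < logn p m)%N by rewrite logn_gt0 mem_primes pr_p m0.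
rewrite Em mulnC hecke_prime_pow // mulf_neq0 ?intr_eq0 //.
apply: IHm => // [|q pr_q qm'].
  rewrite [X in (_ < X)%N]Em ltn_Pmulr // -{1}(expn0 p) ltn_exp2l // prime_gt1 //.
have [qN uq] := Hm q pr_q (eq_ind_r (fun x => (q %| x)%N) (dvdn_mulr _ qm') Em).
split=> //; suff -> : logn q m' = logn q m by [].
have qp : q != p by apply: contraNneq pm' => <-.
rewrite [in RHS]Em lognM // ?expn_gt0 ?(prime_gt0 pr_p) // lognX.
by rewrite [logn q p]logn_prime // (negPf qp) muln0 addn0.
Qed.

End Hecke.

(** * Sums of two squares *)

(** Otherwise - 1 would be a square z^2 modulo q, while z^(q - 1) = 1 and
(q - 1) / 2 is odd. *)
Lemma prime_3mod4_sum2sqr (q x y : nat) : prime q -> (q %% 4 = 3)%N ->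
  (q %| x ^ 2 + y ^ 2)%N -> (q %| x)%N && (q %| y)%N.
Proof.
move=> pr_q q3 qxy.
have q_gt1 := prime_gt1 pr_q.
have natF (n : nat) : (n%:R == 0 :> 'F_q) = (q %| n)%N.
  by rewrite -(dvdn_pcharf (pchar_Fp pr_q)).
have sum0 : (x%:R : 'F_q) ^+ 2 + y%:R ^+ 2 = 0.
  by apply/eqP; rewrite -!natrX -natrD natF.
have qx_qy : (q %| x)%N = (q %| y)%N.
  rewrite -!natF; apply/eqP/eqP => h; move: sum0; rewrite h expr0n /= ?add0r ?addr0;
  by move/eqP; rewrite expf_eq0 => /eqP.
rewrite -qx_qy andbb; apply: contraT => nqx.
have x0 : (x%:R : 'F_q) != 0 by rewrite natF.
have y0 : (y%:R : 'F_q) != 0 by rewrite natF -qx_qy.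
pose z : 'F_q := x%:R / y%:R.
have z2 : z ^+ 2 = -1.
  rewrite /z expr_div_n; apply: (mulIf (expf_neq0 2 y0)); rewrite divfK ?expf_neq0 //.
  by rewrite mulN1r; apply/eqP; rewrite -addr_eq0 sum0.
have z0 : z != 0 by rewrite mulf_neq0 ?invr_neq0.
have : z ^+ q.-1 = 1.
  apply: (mulIf z0); rewrite -exprSr prednK ?prime_gt0 // mul1r.
  by have := expf_card z; rewrite card_Fp.
have -> : q.-1 = (2 * (q %/ 4).*2.+1)%N by have := divn_eq q 4; lia.
rewrite exprM z2 exprS mulN1r -signr_odd odd_double expr0 => /eqP.
rewrite eq_sym -subr_eq0 opprK -[1 + 1]/(2%:R) natF gtnNdvd //.
by case: (q) q_gt1 q3 => [|[|[|]]].
Qed.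

Lemma logn_sum2sqr_even (q x y : nat) : prime q -> (q %% 4 = 3)%N ->
  ~~ odd (logn q (x ^ 2 + y ^ 2)).
Proof.
move=> pr_q q3; move: {2}(x + y)%N (leqnn (x + y)) => n.
elim: n x y => [|n IHn] x y le_xy.
  by move: le_xy; rewrite leqn0 addn_eq0 => /andP[/eqP -> /eqP ->]; rewrite logn0.
have [qxy|nqxy] := boolP (q %| x ^ 2 + y ^ 2)%N; last first.
  by rewrite lognE (negPf nqxy) !andbF.
have [->|xy0] := posnP (x ^ 2 + y ^ 2)%N; first by rewrite logn0.
have /andP[/dvdnP[x' Ex] /dvdnP[y' Ey]] := prime_3mod4_sum2sqr pr_q q3 qxy.
have Exy : (x ^ 2 + y ^ 2 = q ^ 2 * (x' ^ 2 + y' ^ 2))%N by rewrite Ex Ey; ring.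
have xy'0 : (0 < x' ^ 2 + y' ^ 2)%N.
  by move: xy0; rewrite Exy muln_gt0 => /andP[].
rewrite Exy lognM ?expn_gt0 ?(prime_gt0 pr_q) // pfactorK // oddD /=.
apply: IHn; rewrite Ex Ey -mulnDl in le_xy.
have s0 : (0 < x' + y')%N by case: (x') (y') xy'0 => [|?] [|?].
have : ((x' + y') * 2 <= (x' + y') * q)%N by rewrite leq_mul2l prime_gt1 ?orbT.
lia.
Qed.

(** * Gaps between nonzero coefficients *)

(** Greedy choice.  The integer t = M k is the largest multiple of M with
t^2 <= n, and j is minimal with n <= t^2 + (M j + 1)^2.  If j > 0 then
z = M (j - 1) + 1 satisfies t^2 + z^2 < n < (t + M)^2, which bounds z^2, and the
excess over n is at most (z + M)^2 - z^2. *)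
Lemma sum2sqr_near (M n : nat) : (0 < M)%N -> exists k j z t : nat,
  [/\ (n <= (M * k) ^ 2 + (M * j + 1) ^ 2)%N,
      ((M * k) ^ 2 + (M * j + 1) ^ 2 <= n + 2 * M * z + M ^ 2)%N,
      (z ^ 2 <= 2 * M * t + M ^ 2)%N & (t ^ 2 <= n)%N].
Proof.
move=> M0.
have ex_k : exists k, (n < (M * k.+1) ^ 2)%N by exists n; nia.
case: (ex_minnP ex_k) => k lt_n min_k.
have le_n : ((M * k) ^ 2 <= n)%N.
  case: k lt_n min_k => [|k] _ min_k; first by rewrite muln0.
  by rewrite leqNgt; apply/negP => /min_k; rewrite ltnn.
have ex_j : exists j, (n <= (M * k) ^ 2 + (M * j + 1) ^ 2)%N by exists n; nia.
case: (ex_minnP ex_j) => j ge_n min_j.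
case: j ge_n min_j => [|j] ge_n min_j.
  exists k, 0%N, 0%N, 0%N; split => //; nia.
have lt_j : ((M * k) ^ 2 + (M * j + 1) ^ 2 < n)%N.
  by rewrite ltnNge; apply/negP => /min_j; rewrite ltnn.
exists k, j.+1, (M * j + 1)%N, (M * k)%N; split => //; nia.
Qed.

Lemma is_gap_le (R : realType) (a : nat -> R[i]) (n m : nat) :
  (n <= m)%N -> a m != 0 -> exists2 i, is_gap a n i & (i <= m - n)%N.
Proof.
move=> le_nm am0; rewrite /is_gap; case: (boolP (a n == 0)) => [an0|_]; last by exists 0%N.
have ex_k : exists k, a (n + k)%N != 0 by exists (m - n)%N; rewrite subnKC.
case: (ex_minnP ex_k) => -[|k] nz_k min_k; first by rewrite addn0 an0 in nz_k.
exists k; last by have := min_k (m - n)%N; rewrite subnKC // => h; have := h am0; lia.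
split=> [j le_jk|l all0].
  by apply/eqP; apply: contraTT le_jk => /min_k; lia.
by rewrite leqNgt; apply/negP => /all0 e; rewrite e eqxx in nz_k.
Qed.

(** With s = n^(1/4): t <= s^2, hence z <= 2 M s. *)
Lemma sum2sqr_error_bound (R : realType) (M n z t : nat) : (0 < n)%N ->
  (z ^ 2 <= 2 * M * t + M ^ 2)%N -> (t ^ 2 <= n)%N ->
  (2 * M * z + M ^ 2)%:R <= 5 * M%:R ^+ 2 * (n%:R `^ 4^-1) :> R.
Proof.
move=> n0 le_z le_t; set s := _ `^ _.
have s1 : 1 <= s.
  apply: (@le_trans _ _ (1 `^ 4^-1)); first by rewrite powR1.
  apply: ge0_ler_powR; rewrite ?nnegrE ?ler1n ?invr_ge0 ?ler0n //.
have s4 : s ^+ 4 = n%:R.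
  by rewrite /s -powR_mulrn ?powR_ge0 // -powRrM mulVf ?pnatr_eq0 // powRr1.
have {}le_t : t%:R <= s ^+ 2.
  rewrite -(@ler_pXn2r _ 2) ?nnegrE ?exprn_ge0 ?(le_trans ler01 s1) //.
  by rewrite -exprM s4 -natrX ler_nat.
have le_z' : (z%:R : R) ^+ 2 <= 2 * M%:R * t%:R + M%:R ^+ 2.
  by rewrite -!natrX -!natrM -natrD ler_nat.
have M0 : 0 <= M%:R :> R by rewrite ler0n.
have {le_z'} : z%:R <= 2 * M%:R * s.
  rewrite -(@ler_pXn2r _ 2) ?nnegrE ?mulr_ge0 ?(le_trans ler01 s1) //.
  apply: (le_trans le_z').
  have h1 : 2 * M%:R * t%:R <= 2 * M%:R * s ^+ 2 by rewrite ler_wpM2l // mulr_ge0.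
  have h2 : M%:R <= M%:R ^+ 2 :> R.
    by rewrite -natrX ler_nat; case: (M) => // k; nia.
  have s2 : 1 <= s ^+ 2 by rewrite expr_ge1 // (le_trans ler01 s1).
  have h3 : M%:R * s ^+ 2 <= M%:R ^+ 2 * s ^+ 2 by rewrite ler_wpM2r // (le_trans ler01 s2).
  have h4 : M%:R ^+ 2 <= M%:R ^+ 2 * s ^+ 2 by rewrite ler_peMr // exprn_ge0.
  rewrite !exprMn; lra.
rewrite natrD natrX !natrM => hz.
have h1 : 2 * M%:R * z%:R <= 2 * M%:R * (2 * M%:R * s) by rewrite ler_wpM2l // mulr_ge0.
have h2 : M%:R ^+ 2 <= M%:R ^+ 2 * s by rewrite ler_peMr // exprn_ge0.
lra.
Qed.

(** This integer is 1 modulo 6N, so its prime factors p exceed 3 and do not divide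
N.  If a_p = 0 then p = 3 modulo 4, and p has an even exponent in it. *)
Lemma sum2sqr_coef_neq0 (R : realType) (N k j : nat) (E : ellcurve rat)
    (f : R[i] -> R[i]) (a : nat -> R[i]) :
  conductor E N -> has_cyclic_4_isogeny E -> attached_eigenform E N f a ->
  a ((6 * N * k) ^ 2 + (6 * N * j + 1) ^ 2)%N != 0.
Proof.
move=> condE isogE [[_ _ a1E _ hecke] [W minW apE]].
have [t [x /halved_root_change hE]] := cyclic4_halved_root isogE.
have [[u [r0 [s [t0 [u0 chg]]]]] _] := minW.
have [r [c params]] := halved_root_int (hE _ _ _ _ _ chg u0).
set m := (_ + _)%N.
apply: (hecke_neq0 (N := N) (ap := trace_frob W) a1E apE hecke) => [|p pr_p pm].
  by rewrite /m addn1 addn_gt0 orbT.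
have coprime_p : ~~ (p %| 6 * N)%N.
  apply/negP => pM; move: pm; rewrite /m dvdn_addr; last first.
    by rewrite Euclid_dvdX // dvdn_mulr.
  rewrite Euclid_dvdX // => /andP[+ _].
  by rewrite (dvdn_addr _ (dvdn_mulr _ pM)) dvdn1 gtn_eqF // prime_gt1.
move: coprime_p; rewrite Euclid_dvdM // negb_or => /andP[p6 pN]; split=> //.
have p_gt3 : (3 < p)%N by case: p pr_p {pm pN} p6 => [|[|[|[|]]]].
have [ap0|ap_neq0] := eqVneq (trace_frob W p) 0; last exact: lucas_neq0.
have p4 : (p %% 4 = 3)%N.
  have disc0 := conductor_good_reduction condE minW pr_p pN.
  have : (p %% 4 != 1)%N.
    by apply: contra_eqN ap0 => /eqP p1; exact: (trace_frob_neq0 params pr_p p1 disc0).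
  have : odd p by case: (even_prime pr_p) p_gt3 => // ->.
  lia.
have /negPf ev := logn_sum2sqr_even (6 * N * k) (6 * N * j + 1) pr_p p4.
rewrite ap0 -(odd_double_half (logn p m)) ev add0n lucas0_double expf_neq0 //.
by rewrite oppr_eq0 eqz_nat -lt0n prime_gt0.
Qed.

Theorem theorem3p3 (R : realType) (N : nat) :
  exists C : R, 0 < C /\
    forall (E : ellcurve rat) (f : R[i] -> R[i]) (a : nat -> R[i]),
      conductor E N ->
      has_cyclic_4_isogeny E ->
      attached_eigenform E N f a ->
      exists n0 : nat, forall n : nat, (n0 <= n)%N ->
        exists2 i : nat, is_gap a n i & i%:R <= C * (n%:R `^ 4^-1).
Proof.
(* The summand 1 makes the constant positive even for N = 0. *)
exists (5 * (6 * N)%:R ^+ 2 + 1); split.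
  by rewrite ltr_wpDl // mulr_ge0 ?exprn_ge0 ?ler0n.
move=> E f a condE isogE attE.
exists 1%N => n n0.
have M0 : (0 < 6 * N)%N by case: condE => N0 _; rewrite muln_gt0.
have [k [j [z [t [le_n le_m le_z le_t]]]]] := sum2sqr_near n M0.
have am := sum2sqr_coef_neq0 k j condE isogE attE.
have [i gap_i le_i] := is_gap_le le_n am.
exists i => //; rewrite mulrDl mul1r.
apply: (@le_trans _ _ (2 * (6 * N) * z + (6 * N) ^ 2)%:R).
  by rewrite ler_nat (leq_trans le_i) //; lia.
by apply: (le_trans (sum2sqr_error_bound R n0 le_z le_t)); rewrite lerDl powR_ge0.
Qed.
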